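(* Let $n$ and $k$ be integers with $1\le k\le n-1$, and let $W_{n,k}$ be the number of balls that do not end up in their assigned pit in the placement procedure with $n$ balls, $n$ pits and $k$ absent-minded balls described in the context. Then the variance of $W_{n,k}$ is $$ \mathbb{V}(W_{n,k}) = k\left[\frac{2(1-n+kn)-n^2-k}{n^2(n-1)}+\frac{2}{nk}+\left(1+\frac{2}{n}\right)(H_n-H_k)-k\sum_{\ell=k+1}^n\frac{1}{\ell^2}\right]. $$
   Context: Placement procedure: there are $n$ balls numbered $1,\ldots,n$ and a box with $n$ pits numbered $1,\ldots,n$; each pit holds one ball, and the pit assigned to ball $i$ is pit $i$. The first $k$ (absent-minded) balls are placed completely at random in $k$ distinct pits, i.e. the vector of pit numbers taken by balls $1,\ldots,k$ is uniformly distributed over all $k$-tuples of distinct elements of $\{1,\ldots,n\}$. Then the balls $k+1,k+2,\ldots,n$ are placed one after another in this order: ball $i$ takes pit $i$ if that pit is empty; otherwise, conditionally on all previous placements, it takes a pit chosen uniformly at random among all currently empty pits. For $i\in\{1,\ldots,n\}$ let $A_i$ be the event that ball $i$ is placed in pit $i$, and let $W_{n,k}=\sum_{i=1}^n \mathbf{1}_{A_i^c}$, where $A_i^c$ is the complement of $A_i$. $\mathbb{V}$ denotes variance, and $H_m=1+1/2+\cdots+1/m$ is the $m$th harmonic number. *)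

(* Defs.v *)
From mathcomp Require Import all_boot all_order all_algebra.
From mathcomp Require Import all_classical all_reals all_analysis.

Set Implicit Arguments.
Unset Strict Implicit.
Unset Printing Implicit Defensive.

Import Order.TTheory GRing.Theory Num.Theory.
Local Open Scope classical_set_scope.
Local Open Scope ring_scope.

Definition cond_prob d (T : measurableType d) (R : realType)
    (P : probability T R) (A B : set T) : R :=
  fine (P (A `&` B)) / fine (P B).

(* Balls and pits are indexed from 0: ball i and pit i, for i : 'I_n, carry the
   number i + 1, so the absent-minded balls are those with i < k.
   [X i w] is the pit taken by ball i in the outcome w. *)

(* The first m balls have taken the pits prescribed by h. *)
Definition history (T : Type) (n : nat) (X : 'I_n -> T -> 'I_n) (m : nat)
    (h : 'I_n -> 'I_n) : set T :=
  [set w | forall j : 'I_n, (j < m)%N -> X j w = h j].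

Definition empty_pits (n : nat) (i : 'I_n) (h : 'I_n -> 'I_n) : {set 'I_n} :=
  ~: [set h j | j : 'I_n & (j < i)%N].

(* The conditional probability that ball i, not absent-minded, takes pit p,
   given that the previous balls have been placed according to h. *)
Definition step_prob (R : realType) (n : nat) (i : 'I_n) (h : 'I_n -> 'I_n)
    (p : 'I_n) : R :=
  let E := empty_pits i h in
  if i \in E then (p == i)%:R else (p \in E)%:R / #|E|%:R.

(* Distinct h can give the same history event: only the values of h on the
   first m balls matter.  The first k of them range over all k-tuples of
   distinct pits, of which there are n ^_ k = n (n - 1) ... (n - k + 1). *)
Record placement d (T : measurableType d) (R : realType)
    (P : probability T R) (n k : nat) (X : 'I_n -> T -> 'I_n) : Prop := {
  placement_measurable : forall i p : 'I_n, measurable [set w | X i w = p];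
  placement_absent_minded : forall h : 'I_n -> 'I_n,
    {in [pred j : 'I_n | (j < k)%N] &, injective h} ->
    P (history X k h) = ((n ^_ k)%:R^-1)%:E;
  placement_step : forall (i : 'I_n) (h : 'I_n -> 'I_n) (p : 'I_n),
    (k <= i)%N -> (0 < P (history X i h))%E ->
    cond_prob P [set w | X i w = p] (history X i h) = step_prob R i h p }.

Definition misplaced (T : Type) (R : realType) (n : nat)
    (X : 'I_n -> T -> 'I_n) : T -> R :=
  fun w => \sum_(i < n) \1_(~` [set v | X i v = i]) w.

Definition harmonic_number (R : realType) (m : nat) : R :=
  \sum_(1 <= j < m.+1) j%:R^-1.

(* Main.v *)
Require Import Defs.
From mathcomp Require Import all_boot all_order all_algebra all_fingroup.
From mathcomp Require Import all_classical all_reals all_analysis.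
From mathcomp Require Import ring lra zify.

Set Implicit Arguments.
Unset Strict Implicit.
Unset Printing Implicit Defensive.

Import Order.TTheory GRing.Theory Num.Theory.
Local Open Scope ring_scope.

(** Pits and balls are numbered from 0.  Write W = k - M + Y, where M counts the
    absent-minded balls sitting in their own pits and Y the later balls that are
    misplaced.

    Ball i >= k is misplaced exactly when its pit is occupied at its arrival,
    so everything about Y is carried by the random set S_i of occupied pits
    after i placements.  Let F be a set of absent-minded balls, D_F the event that
    all of them are in their own pits, and C(i, F) the union of F and the set of
    pits k, ..., i - 1, which are all occupied at that time.  On D_F, S_i is uniformly distributed
    over the i-element sets that contain C(i, F), and it stays so when i >= k
    increases, even after weighting by functions of the events that the pits of
    the balls k, ..., i - 1 were occupied on arrival
    ([uniformly_occupied_step]).  Indeed a set B' of size i + 1 containing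
    C(i + 1, F) arises in two ways: from B' minus i, in which case ball i goes to
    its own pit, or from B' minus p, with p among the m = k - |F| elements of B'
    outside C(i + 1, F), in which case pit i was occupied and p was drawn with
    probability 1 / (n - i).  The number of ways does not depend on B', so
    the weight of every admissible set is multiplied by the same factor.

    Iterating up to i = n, where only the full set is admissible, factorises the
    law: given D_F, the balls j >= k are misplaced independently, with
    probabilities m / (n - j + m) ([mean_fixes_misplaced]).  Initially, uniformity
    and the values P(D_F) = 1 / (n (n - 1) ... (n - |F| + 1)) come from the
    invariance of the law of the first k placements under permutations of the
    pits ([mean_perm], [fixes_uniformly_occupied], [mean_fixes]).

    The cases |F| <= 2 give all first and second moments of M and Y, with
    l = n - j + k running over k + 1, ..., n; the variance is then an identity
    between rational expressions.  Since the variance only involves the law of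
    the vector of pits, which is finitely supported, the moments are finite sums
    against the weights P(X = h) ([outcome_placement_law],
    [expectation_outcome]). *)

(** * Histories and occupied pits *)

Definition occupied (n i : nat) (h : 'I_n -> 'I_n) : {set 'I_n} :=
  [set h j | j : 'I_n & (j < i)%N].

Definition agree (n i : nat) (h g : 'I_n -> 'I_n) : bool :=
  [forall j : 'I_n, (j < i)%N ==> (h j == g j)].

Section History.
Variable n : nat.
Implicit Types (h g : 'I_n -> 'I_n).

Lemma agreeP i h g :
  reflect (forall j : 'I_n, (j < i)%N -> h j = g j) (agree i h g).
Proof.
apply: (iffP forallP) => [A j ji|A j]; first by move/implyP: (A j) => /(_ ji)/eqP.
by apply/implyP => ji; rewrite A.
Qed.

Lemma agreeW i j h g : (i <= j)%N -> agree j h g -> agree i h g.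
Proof. by move=> ij /agreeP A; apply/agreeP => l li; rewrite A// (leq_trans li). Qed.

Lemma occupied_agree i h g : agree i h g -> occupied i h = occupied i g.
Proof.
by move=> /agreeP A; apply: eq_in_imset => j; rewrite inE => /A.
Qed.

Lemma mem_occupied i h (j : 'I_n) : (j < i)%N -> h j \in occupied i h.
Proof. by move=> ji; apply: imset_f; rewrite inE. Qed.

Lemma occupiedS (i : 'I_n) h : occupied i.+1 h = h i |: occupied i h.
Proof.
rewrite /occupied -imsetU1; suff -> : [set j : 'I_n | (j < i.+1)%N] =
  i |: [set j : 'I_n | (j < i)%N] by [].
by apply/finset.setP => j; rewrite !inE ltnS leq_eqVlt.
Qed.

Lemma card_occupied i h : (i <= n)%N ->
  {in [pred j : 'I_n | (j < i)%N] &, injective h} -> #|occupied i h| = i.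
Proof.
move=> ile hinj; rewrite card_in_imset; last first.
  by move=> x y; rewrite !inE => xi yi; apply: hinj.
have -> : [set j : 'I_n | (j < i)%N] = [set widen_ord ile x | x : 'I_i].
  apply/finset.setP => j; rewrite inE; apply/idP/imsetP => [ji|[x _ ->]]; last exact: ltn_ord x.
  by exists (Ordinal ji) => //; apply: val_inj.
by rewrite card_imset ?card_ord// => x y /(congr1 val) /= /val_inj.
Qed.

Lemma empty_pitsE (i : 'I_n) h : empty_pits i h = ~: occupied i h.
Proof. by []. Qed.

End History.

(** * Placement laws on the finite set of outcomes *)

(** The law of the pits taken by all the balls, as weights on outcomes.  The
    conditional probabilities of the placement procedure appear in product form,
    which also covers histories of probability zero. *)
Record placement_law (R : realType) (n k : nat)
    (w : {ffun 'I_n -> 'I_n} -> R) : Prop := {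
  law_ge0 : forall h, 0 <= w h;
  law_total : \sum_h w h = 1;
  law_absent_minded : forall g : 'I_n -> 'I_n,
    {in [pred j : 'I_n | (j < k)%N] &, injective g} ->
    \sum_(h : {ffun 'I_n -> 'I_n} | agree k h g) w h = (n ^_ k)%:R^-1;
  law_step : forall (i : 'I_n) (g : 'I_n -> 'I_n) (p : 'I_n), (k <= i)%N ->
    \sum_(h : {ffun 'I_n -> 'I_n} | agree i h g && (h i == p)) w h
      = (\sum_(h : {ffun 'I_n -> 'I_n} | agree i h g) w h) * step_prob R i g p }.

Section FiniteModel.
Variables (R : realType) (n k : nat) (w : {ffun 'I_n -> 'I_n} -> R).
Hypotheses (kn : (k <= n)%N) (wP : placement_law k w).
Implicit Types (h : {ffun 'I_n -> 'I_n}) (f : {ffun 'I_n -> 'I_n} -> R).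
Implicit Types (B C F J : {set 'I_n}).

Definition mean f : R := \sum_h w h * f h.

Definition determined (i : nat) f := forall h h', agree i h h' -> f h = f h'.

Lemma eq_mean f f' : (forall h, w h != 0 -> f h = f' h) -> mean f = mean f'.
Proof.
move=> ff; apply: eq_bigr => h _.
by have [->|/ff->//] := eqVneq (w h) 0; rewrite !mul0r.
Qed.

Lemma meanD f f' : mean (fun h => f h + f' h) = mean f + mean f'.
Proof. by rewrite -big_split; apply: eq_bigr => h _; rewrite mulrDr. Qed.

Lemma meanZ c f : mean (fun h => c * f h) = c * mean f.
Proof. by rewrite big_distrr; apply: eq_bigr => h _; rewrite /= mulrCA. Qed.

Lemma mean_cst c : mean (fun=> c) = c.
Proof. by rewrite /mean -big_distrl /= (law_total wP) mul1r. Qed.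

Lemma mean_sum (I : finType) (Q : pred I) (f : I -> {ffun 'I_n -> 'I_n} -> R) :
  mean (fun h => \sum_(i | Q i) f i h) = \sum_(i | Q i) mean (f i).
Proof.
by rewrite exchange_big; apply: eq_bigr => h _; rewrite big_distrr.
Qed.

Definition restr h : {ffun 'I_k -> 'I_n} := [ffun x => h (widen_ord kn x)].

Definition extend (t : {ffun 'I_k -> 'I_n}) : {ffun 'I_n -> 'I_n} :=
  [ffun j => oapp t j (insub (val j))].

Lemma extendE t (x : 'I_k) : extend t (widen_ord kn x) = t x.
Proof. by rewrite ffunE /= valK. Qed.

Lemma agree_extend h t : agree k h (extend t) = (restr h == t).
Proof.
apply/agreeP/eqP => [A|<- j jk].
  by apply/ffunP => x; rewrite ffunE A ?extendE//; exact: ltn_ord x.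
have -> : j = widen_ord kn (Ordinal jk) by apply: val_inj.
by rewrite extendE ffunE.
Qed.

Definition inj_absent_minded h :=
  injectiveb (restr h).

Lemma inj_absent_mindedP h :
  reflect {in [pred j : 'I_n | (j < k)%N] &, injective h} (inj_absent_minded h).
Proof.
apply: (iffP (injectiveP _)) => hinj x y.
  rewrite !inE => xk yk; have := hinj (Ordinal xk) (Ordinal yk).
  rewrite !ffunE; have -> : widen_ord kn (Ordinal xk) = x by apply: val_inj.
  have -> : widen_ord kn (Ordinal yk) = y by apply: val_inj.
  by move=> H /H [] xy; apply: val_inj.
rewrite !ffunE => /hinj; rewrite !inE => /(_ (ltn_ord x) (ltn_ord y)).
by move/(congr1 val) => /= /val_inj.
Qed.

(** The injective k-tuples already have total mass one, because there are exactly
    [n ^_ k] of them; hence the others have mass zero. *)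
Lemma law_restr (t : {ffun 'I_k -> 'I_n}) :
  \sum_(h | restr h == t) w h = if injectiveb t then (n ^_ k)%:R^-1 else 0.
Proof.
pose mass (t : {ffun 'I_k -> 'I_n}) := \sum_(h | restr h == t) w h.
have massE (u : {ffun 'I_k -> 'I_n}) : injectiveb u -> mass u = (n ^_ k)%:R^-1.
  move=> /injectiveP uinj; rewrite /mass -(law_absent_minded wP (g := extend u)).
    by apply: eq_bigl => h; rewrite agree_extend.
  apply/inj_absent_mindedP/injectiveP => x y.
  by rewrite !ffunE /= !valK => /uinj.
have total : \sum_u mass u = 1.
  by rewrite -(law_total wP) (partition_big restr xpredT).
have mass_ge0 u : 0 <= mass u by apply: sumr_ge0 => h _; exact: (law_ge0 wP).
have massN : \sum_(u : {ffun 'I_k -> 'I_n} | ~~ injectiveb u) mass u = 0.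
  move: total; rewrite (bigID (fun u : {ffun 'I_k -> 'I_n} => injectiveb u)) /=.
  rewrite (eq_bigr (fun=> (n ^_ k)%:R^-1)); last by move=> u /massE.
  rewrite sumr_const.
  have -> : #|[pred u : {ffun 'I_k -> 'I_n} | injectiveb u]| = (n ^_ k)%N.
    rewrite -[n in RHS]card_ord -[k in RHS]card_ord -card_inj_ffuns.
    by apply: eq_card => u; rewrite !inE.
  rewrite -[_ *+ _]mulr_natr mulVf; last by rewrite pnatr_eq0 -lt0n ffact_gt0.
  by move/eqP; rewrite -subr_eq0 addrAC subrr add0r => /eqP.
case: ifPn => [/massE//|tN].
have := psumr_eq0P (fun u _ => mass_ge0 u) massN. by move/(_ t tN).
Qed.

Lemma law_injective h : w h != 0 -> {in [pred j : 'I_n | (j < k)%N] &, injective h}.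
Proof.
move=> wh0; apply/inj_absent_mindedP; apply: contraNT wh0 => hN.
have := law_restr (restr h); rewrite -/(inj_absent_minded h) (negbTE hN) => s0.
by rewrite (psumr_eq0P (fun u _ => law_ge0 wP u) s0).
Qed.

Lemma mean_absent_minded f : determined k f ->
  mean f = (n ^_ k)%:R^-1 *
           \sum_(t : {ffun 'I_k -> 'I_n} | injectiveb t) f (extend t).
Proof.
move=> fdet; rewrite /mean (partition_big restr xpredT)//= big_distrr /=.
rewrite [RHS]big_mkcond /=; apply: eq_bigr => t _.
rewrite (eq_bigr (fun h => w h * f (extend t))); last first.
  by move=> h ht; rewrite (fdet h (extend t))// agree_extend.
by rewrite -big_distrl law_restr /=; case: ifP; rewrite ?mul0r.
Qed.

(** Relabelling the pits maps the uniform law on injective k-tuples to itself. *)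
Lemma mean_perm (s : {perm 'I_n}) f : determined k f ->
  mean (fun h => f [ffun j => s (h j)]) = mean f.
Proof.
move=> fdet; rewrite !mean_absent_minded//; last first.
  move=> h h' /agreeP A; apply: fdet; apply/agreeP => j jk.
  by rewrite !ffunE A.
congr (_ * _).
pose push (u : {perm 'I_n}) (t : {ffun 'I_k -> 'I_n}) := [ffun x => u (t x)].
have pushK : cancel (push s) (push s^-1%g).
  by move=> t; apply/ffunP => x; rewrite !ffunE permK.
have pushVK : cancel (push s^-1%g) (push s).
  by move=> t; apply/ffunP => x; rewrite !ffunE permKV.
rewrite [RHS](reindex (push s)) /=; last first.
  by exists (push s^-1%g) => t _.
apply: eq_big => t.
  apply/injectiveP/injectiveP => tinj x y.
    by rewrite !ffunE => /perm_inj/tinj.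
  by move=> E; apply: tinj; rewrite !ffunE E.
move=> _; apply: fdet; rewrite agree_extend; apply/eqP/ffunP => x.
by rewrite !ffunE /= valK.
Qed.

Definition fixes F h : bool := [forall a in F, h a == a].

Lemma fixesU1 (a : 'I_n) F h : fixes (a |: F) h = fixes F h && (h a == a).
Proof.
apply/forall_inP/andP => [A|[/forall_inP A ha] x].
  split; last by rewrite A ?setU11.
  by apply/forall_inP => x xF; rewrite A ?setU1r.
by rewrite !inE => /predU1P[->|/A].
Qed.

Lemma fixes_agree i F h h' : F \subset [set j : 'I_n | (j < i)%N] ->
  agree i h h' -> fixes F h = fixes F h'.
Proof.
move=> /fintype.subsetP Fi /agreeP A; apply: eq_forallb => a.
by case: (boolP (a \in F)) => //= /Fi; rewrite inE => /A ->.
Qed.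

Lemma fixes_perm F (s : {perm 'I_n}) h : {in F, s =1 id} ->
  fixes F [ffun j => s (h j)] = fixes F h.
Proof.
move=> sF; apply: eq_forallb => a; case: (boolP (a \in F)) => //= /sF sa.
by rewrite ffunE -{2}sa (inj_eq perm_inj).
Qed.

(** Given that the balls of [F] are in their own pits, ball [a] is in each of the
    [n - #|F|] pits outside [F] with the same probability: exchange such a pit with
    pit [a]. *)
Lemma mean_fixesU1 (a : 'I_n) F : F \subset [set j : 'I_n | (j < k)%N] -> (a < k)%N ->
  a \notin F ->
  mean (fun h => (fixes F h)%:R)
    = (n - #|F|)%:R * mean (fun h => (fixes (a |: F) h)%:R).
Proof.
move=> Fk ak aF.
transitivity (mean (fun h => \sum_p (fixes F h && (h a == p))%:R)).
  apply: eq_mean => h _; rewrite (bigD1 (h a)) //= eqxx andbT big1 ?addr0// => p.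
  by rewrite eq_sym => /negbTE ->; rewrite andbF.
rewrite mean_sum (bigID (mem F)) /= [X in X + _]big1 ?add0r; last first.
  move=> p pF; rewrite /mean big1// => h _.
  have [->|/law_injective hinj] := eqVneq (w h) 0; first by rewrite mul0r.
  case: andP => [[/forall_inP hF /eqP hap]|_]; last by rewrite mulr0.
  have pk : (p < k)%N by move/fintype.subsetP: Fk => /(_ _ pF); rewrite inE.
  case/negP: aF; rewrite (hinj a p) ?inE//.
  by rewrite hap (eqP (hF _ pF)).
rewrite (eq_bigr (fun=> mean (fun h => (fixes (a |: F) h)%:R))).
  rewrite sumr_const [RHS]mulr_natl; congr (_ *+ _).
  have cardCF : (#|F| + #|[predC F]| = n)%N by rewrite cardC card_ord.
  rewrite -[X in (X - _)%N]cardCF addKn.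
  by apply: eq_card => p; rewrite !inE.
move=> p pF; rewrite -(mean_perm (tperm p a)); last first.
  move=> h h' A; rewrite (fixes_agree Fk A).
  by move/agreeP: A => ->.
apply: eq_mean => h _; rewrite fixesU1 fixes_perm; last first.
  move=> x xF; rewrite tpermD//; first by apply: contraNneq pF => ->.
  by apply: contraNneq aF => ->.
by rewrite ffunE -{2}(tpermR p a) (inj_eq perm_inj).
Qed.

(** * Uniformity of the set of occupied pits *)

(** Stated for a weight [f] instead of an event, so that products of indicators of
    earlier placements are covered; [c] is the common mass of the admissible
    sets. *)
Definition uniformly_occupied C i f c := forall B,
  mean (fun h => f h * (occupied i h == B)%:R)
    = c * ((C \subset B) && (#|B| == i))%:R.

(** Two sets of the same size are joined by a chain of transpositions, each
    exchanging an element of [B :\: B'] with one of [B' :\: B]; neither is in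
    [F]. *)
Lemma perm_invariant_const (V : Type) F (phi : {set 'I_n} -> V) :
  (forall (s : {perm 'I_n}) B, {in F, s =1 id} -> phi (s @: B) = phi B) ->
  forall B B', F \subset B -> F \subset B' -> #|B| = #|B'| -> phi B = phi B'.
Proof.
move=> phiP B B' FB FB' cB.
have [m] := ubnP #|B :\: B'|; elim: m => // m IHm in B FB cB *; rewrite ltnS => leBm.
have [BB'|/subsetPn[x xB xB']] := boolP (B \subset B').
  by congr phi; apply/eqP; rewrite eqEcard BB' cB leqnn.
have [y yB' yB] : exists2 y, y \in B' & y \notin B.
  apply/subsetPn; apply: contra xB' => B'B.
  suff -> : B' = B by [].
  by apply/eqP; rewrite eqEcard B'B cB leqnn.
have xy : x != y by apply: contraTneq yB' => <-.
have yF : y \notin F by apply: contra yB => /(fintype.subsetP FB).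
have xF : x \notin F by apply: contra xB' => /(fintype.subsetP FB').
have tF : {in F, tperm x y =1 id}.
  move=> z zF; rewrite tpermD//; first by apply: contraNneq xF => ->.
  by apply: contraNneq yF => ->.
rewrite -(phiP (tperm x y))//; apply: IHm.
- apply/fintype.subsetP => z zF; rewrite -(tF z zF); apply: imset_f.
  exact: (fintype.subsetP FB).
- by rewrite card_imset//; apply: perm_inj.
- apply: leq_trans leBm; apply: proper_card; apply/properP; split.
    apply/fintype.subsetP => z; rewrite !inE => /andP[zB' /imsetP[u uB zu]].
    rewrite zB' /=; move: zB'; rewrite zu; by case: tpermP => [_|_|_ _] //; rewrite yB'.
  exists x; rewrite !inE ?xB ?xB' //= .
  apply/imsetP => -[u uB /eqP]; rewrite -{1}(tpermR x y) (inj_eq perm_inj).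
  by move/eqP => yu; rewrite yu uB in yB.
Qed.

(** Starting point of the induction on time. *)
Lemma fixes_uniformly_occupied F : F \subset [set j : 'I_n | (j < k)%N] ->
  exists c, uniformly_occupied F k (fun h => (fixes F h)%:R) c.
Proof.
move=> Fk.
pose phi B := mean (fun h => (fixes F h)%:R * (occupied k h == B)%:R).
have phi0 B : ~~ ((F \subset B) && (#|B| == k)) -> phi B = 0.
  move=> BN; rewrite /phi /mean big1// => h _.
  have [->|/law_injective hinj] := eqVneq (w h) 0; first by rewrite mul0r.
  rewrite -natrM mulnb; case: andP => [[/forall_inP hF /eqP oB]|_]; last by rewrite mulr0.
  case/negP: BN; rewrite -oB card_occupied// eqxx andbT.
  apply/fintype.subsetP => a aF; rewrite -(eqP (hF _ aF)) mem_occupied//.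
  by move/fintype.subsetP: Fk => /(_ _ aF); rewrite inE.
have phiP (s : {perm 'I_n}) B : {in F, s =1 id} -> phi (s @: B) = phi B.
  move=> sF; rewrite /phi -(mean_perm s); last first.
    by move=> h h' A; rewrite (fixes_agree Fk A) (occupied_agree A).
  apply: eq_mean => h _; rewrite fixes_perm//; congr (_ * _%:R).
  have -> : occupied k [ffun j => s (h j)] = s @: occupied k h.
    by rewrite /occupied -imset_comp; apply: eq_imset => j; rewrite /= ffunE.
  by rewrite (inj_eq (imset_inj perm_inj)).
case: (pickP [pred B : {set 'I_n} | (F \subset B) && (#|B| == k)]) => [B0|none].
  move=> /= /andP[FB0 /eqP cB0]; exists (phi B0) => B.
  have [/andP[FB /eqP cB]|/phi0] := boolP (_ && _); last by rewrite mulr0.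
  by rewrite mulr1; apply: (perm_invariant_const phiP); rewrite ?cB.
exists 0 => B; rewrite mul0r; apply: phi0.
by have /= -> := none B.
Qed.

(** Averaging over the placement of ball [i] while keeping the first [i] placements
    fixed. *)
Lemma mean_step (i : 'I_n) (G : 'I_n -> {ffun 'I_n -> 'I_n} -> R) : (k <= i)%N ->
  (forall p, determined i (G p)) ->
  mean (fun h => G (h i) h) = mean (fun h => \sum_p step_prob R i h p * G p h).
Proof.
move=> ki Gdet.
transitivity (mean (fun h => \sum_p (h i == p)%:R * G p h)).
  apply: eq_mean => h _; rewrite (bigD1 (h i)) //= eqxx mul1r big1 ?addr0// => p.
  by rewrite eq_sym => /negbTE ->; rewrite mul0r.
rewrite !mean_sum; apply: eq_bigr => p _.
(* A history of length i is represented by the outcome that follows it and is the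
   identity from i on. *)
pose trunc (h : {ffun 'I_n -> 'I_n}) : {ffun 'I_n -> 'I_n} :=
  [ffun j : 'I_n => if (j < i)%N then h j else j].
have truncE h g : agree i h (trunc g) = (trunc h == trunc g).
  apply/agreeP/eqP => [A|/ffunP A j ji].
    apply/ffunP => j; rewrite !ffunE; case: ifP => // ji.
    by rewrite A// ffunE ji.
  by have := A j; rewrite [in LHS]ffunE ji.
have truncP h : true -> trunc h \in codom trunc by move=> _; apply: codom_f.
rewrite /mean (partition_big trunc (mem (codom trunc)) truncP) /=.
rewrite [RHS](partition_big trunc (mem (codom trunc)) truncP) /=.
apply: eq_bigr => _ /codomP[g ->].
have Gg h : trunc h == trunc g -> G p h = G p (trunc g).
  by move=> hg; apply: Gdet; rewrite truncE.
have Sg h : trunc h == trunc g -> step_prob R i h p = step_prob R i (trunc g) p.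
  rewrite -truncE => hg.
  by rewrite /step_prob !empty_pitsE (occupied_agree hg).
transitivity ((\sum_(h : {ffun 'I_n -> 'I_n} | agree i h (trunc g) && (h i == p)) w h) * G p (trunc g)).
  rewrite big_mkcondr /= big_distrl /=; apply: eq_big => h; first by rewrite truncE.
  by move=> /Gg ->; case: eqP => _; rewrite ?mul1r ?mul0r ?mulr0.
rewrite (law_step wP)// big_distrl /= big_distrl /=; apply: eq_big => h.
  by rewrite truncE.
by rewrite truncE => hg; rewrite (Sg _ hg) (Gg _ hg) mulrA.
Qed.

(** A ball that finds its pit empty takes it, and one that finds it occupied cannot;
    this holds for all outcomes of positive weight. *)
Lemma mem_occupied_misplaced (i : 'I_n) h : (k <= i)%N -> w h != 0 ->
  (i \in occupied i h) = (h i != i).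
Proof.
move=> ki wh0.
have step_neq0 : step_prob R i h (h i) != 0.
  apply: contraNneq wh0 => s0; have := law_step wP h (h i) ki.
  rewrite s0 mulr0 => /(psumr_eq0P (fun u _ => law_ge0 wP u)) -> //.
  by rewrite eqxx andbT; apply/agreeP.
move: step_neq0; rewrite /step_prob !empty_pitsE !finset.in_setC.
case: (boolP (i \in _)) => /= [iO|iO].
  case: (boolP (h i \in _)) => [_|hO _]; first by rewrite mul0r eqxx.
  by apply/esym; apply: contraNneq hO => ->.
by case: (h i == i); rewrite ?eqxx.
Qed.

(** The step probability depends on the history only through the occupied
    set [B]. *)
Definition pit_choice (i : 'I_n) B (p : 'I_n) : R :=
  if i \in B then (p \notin B)%:R / #|~: B|%:R else (p == i)%:R.

Lemma step_probE (i : 'I_n) (h : 'I_n -> 'I_n) (p : 'I_n) :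
  step_prob R i h p = pit_choice i (occupied i h) p.
Proof.
rewrite /step_prob /pit_choice !empty_pitsE !finset.in_setC.
by case: (i \in _).
Qed.

(** The only set that becomes [B'] when the new element [p] is added is [B' :\ p]. *)
Lemma sum_setU1_eq (Q : pred {set 'I_n}) (p : 'I_n) B' :
  \sum_(B | Q B && (p \notin B)) (p |: B == B')%:R
    = ((p \in B') && Q (B' :\ p))%:R :> R.
Proof.
have eqE B : p \notin B -> (p |: B == B') = (p \in B') && (B == B' :\ p).
  move=> pB; apply/eqP/andP => [<-|[pB' /eqP ->]]; last by rewrite finset.setD1K.
  by rewrite setU11 setU1K.
have [pB'|pB'] /= := boolP (p \in B'); last first.
  by rewrite big1// => B /andP[_ pB]; rewrite eqE// (negbTE pB').
have [QB'|QB'] := boolP (Q _).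
  rewrite (bigD1 (B' :\ p)) /= ?QB' ?setD11//= eqE ?setD11// pB' eqxx big1 ?addr0//.
  by move=> B /andP[/andP[_ pB] BB']; rewrite eqE// (negbTE BB') andbF.
rewrite big1// => B /andP[QB pB]; rewrite eqE//.
by case: eqP => [BB'|_]; [rewrite -BB' QB in QB' | rewrite andbF].
Qed.

(** Counting the predecessors of [B']: [B' :\ i], where ball [i] takes its own pit,
    and [B' :\ p] for the [i - #|C|] elements [p] of [B'] outside [i |: C], where the
    occupied pit [i] forces a draw among [n - i] pits. *)
Lemma sum_pit_choice C (i : 'I_n) (g0 g1 : R) B' : i \notin C ->
  \sum_(B : {set 'I_n} | (C \subset B) && (#|B| == i))
     (if i \in B then g1 else g0)
       * \sum_p pit_choice i B p * (p |: B == B')%:R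
  = (g0 + g1 * ((i - #|C|)%:R / (n - i)%:R))
      * ((i |: C \subset B') && (#|B'| == i.+1))%:R.
Proof.
move=> iC; rewrite (bigID (fun B : {set 'I_n} => i \notin B)) /= mulrDl; congr (_ + _).
  rewrite (eq_bigr (fun B : {set 'I_n} => g0 * (i |: B == B')%:R)); last first.
    move=> B /andP[_ iB]; rewrite (negbTE iB); congr (_ * _).
    rewrite /pit_choice (negbTE iB) (bigD1 i) //= eqxx mul1r big1 ?addr0// => p.
    by move=> /negbTE ->; rewrite mul0r.
  rewrite -big_distrr /= sum_setU1_eq; congr (_ * _%:R); congr nat_of_bool.
  rewrite finset.subUset finset.sub1set subsetD1 iC andbT -andbA.
  case: (boolP (i \in B')) => //= iB'.
  by rewrite (cardsD1 i B') iB' eqSS.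
rewrite (eq_bigr (fun B : {set 'I_n} => \sum_p (g1 / (n - i)%:R)
    * ((p \notin B)%:R * (p |: B == B')%:R))); last first.
  move=> B /andP[/andP[_ /eqP Bi]]; rewrite negbK => iB; rewrite iB big_distrr /=.
  apply: eq_bigr => p _; rewrite /pit_choice iB.
  by rewrite -[#|~: B|](addKn #|B|) cardsC card_ord Bi; ring.
rewrite exchange_big /=.
rewrite (eq_bigr (fun p : 'I_n => g1 / (n - i)%:R
    * ((p \in B' :\: (i |: C)) && ((i |: C \subset B') && (#|B'| == i.+1)))%:R)); last first.
  move=> p _; rewrite -big_distrr /=; congr (_ * _).
  rewrite (eq_bigr (fun B : {set 'I_n} => if p \notin B then (p |: B == B')%:R else 0)); last first.
    by move=> B _; case: (p \notin B); rewrite ?mul1r ?mul0r.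
  rewrite -big_mkcondr /= sum_setU1_eq; congr (_%:R); congr nat_of_bool.
  rewrite !inE negbK negb_or subsetD1 finset.subUset finset.sub1set.
  case: (boolP (p \in B')) => pB' /=; last by rewrite andbF.
  rewrite (cardsD1 p B') pB' eqSS [i == p]eq_sym.
  by case: (_ == nat_of_ord i); case: (p == i); case: (p \in C); case: (C \subset B'); case: (i \in B');
    rewrite ?andbF ?andbT.
rewrite -big_distrr /=; set v := (_ && (_ == _)).
suff -> : \sum_(p < n) ((p \in B' :\: (i |: C)) && v)%:R = (i - #|C|)%:R * v%:R :> R.
  by ring.
rewrite /v; have [/andP[CB' /eqP cB']|_] := boolP (_ && _); last first.
  by rewrite mulr0 big1// => p _; rewrite andbF.
rewrite mulr1 -natr_sum; congr (_%:R).
rewrite -(subnDl 1 i) add1n -cB'.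
have -> : (1 + #|C| = #|i |: C|)%N by rewrite cardsU1 iC.
have <- : (#|B' :\: (i |: C)| = #|B'| - #|i |: C|)%N.
  by rewrite cardsD (finset.setIidPr CB').
rewrite -sum1_card [RHS]big_mkcond /=.
by apply: eq_bigr => p _; rewrite andbT; case: (p \in _).
Qed.

(** Uniformity propagates, with the occupation of pit [i] weighted by [g1] and its
    vacancy by [g0]: the mass of the admissible sets is multiplied by a constant,
    which makes the occupation events independent. *)
Lemma uniformly_occupied_step C (i : 'I_n) f c (g0 g1 : R) :
  (k <= i)%N -> i \notin C -> determined i f ->
  uniformly_occupied C i f c ->
  uniformly_occupied (i |: C) i.+1
    (fun h => f h * (if i \in occupied i h then g1 else g0))
    (c * (g0 + g1 * ((i - #|C|)%:R / (n - i)%:R))).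
Proof.
move=> ki iC fdet fU B'; rewrite -mulrA -sum_pit_choice// big_distrr /=.
pose G p h := f h * (if i \in occupied i h then g1 else g0)
                * (p |: occupied i h == B')%:R.
transitivity (mean (fun h => G (h i) h)).
  by apply: eq_mean => h _; rewrite occupiedS.
rewrite mean_step//; last first.
  by move=> p h h' A; rewrite /G (fdet _ _ A) (occupied_agree A).
transitivity (mean (fun h => \sum_(B : {set 'I_n}) (f h * (occupied i h == B)%:R)
   * ((if i \in B then g1 else g0)
       * \sum_p pit_choice i B p * (p |: B == B')%:R))).
  apply: eq_mean => h _; rewrite (bigD1 (occupied i h)) //= eqxx mulr1.
  rewrite [X in _ + X]big1 ?addr0; last first.
    by move=> B; rewrite eq_sym => /negbTE ->; rewrite mulr0 mul0r.
  rewrite !big_distrr /=; apply: eq_bigr => p _.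
  by rewrite step_probE /G [RHS]mulrA [RHS]mulrCA.
rewrite mean_sum [RHS]big_mkcond /=; apply: eq_bigr => B _.
rewrite -[RHS]/(if _ then c * (_ * _) else 0).
set a := _ * \sum_p _.
transitivity (mean (fun h => f h * (occupied i h == B)%:R) * a).
  by rewrite mulrC -meanZ; apply: eq_mean => h _; rewrite mulrC.
by rewrite fU; case: ifP => _; rewrite ?mulr1 ?mulr0 ?mul0r.
Qed.

(** After all placements the full set is the only admissible one. *)
Lemma uniformly_occupied_mean C f c : uniformly_occupied C n f c -> mean f = c.
Proof.
move=> fU; transitivity (mean (fun h => \sum_(B : {set 'I_n}) f h * (occupied n h == B)%:R)).
  apply: eq_mean => h _; rewrite (bigD1 (occupied n h)) //= eqxx mulr1.
  by rewrite big1 ?addr0// => B; rewrite eq_sym => /negbTE ->; rewrite mulr0.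
rewrite mean_sum (bigD1 [set: 'I_n])//= fU finset.subsetT cardsT card_ord eqxx mulr1.
rewrite big1 ?addr0// => B BT; rewrite fU.
case: (#|B| =P n) => [Bn|_]; last by rewrite andbF mulr0.
by case/eqP: BT; apply/eqP; rewrite eqEcard finset.subsetT cardsT card_ord Bn leqnn.
Qed.

(** The weights [g1 = 1] and [g0 = (j \notin J)] select the event that the pits of all
    balls in [J] are occupied on arrival. *)
Lemma uniformly_occupied_prod F J : F \subset [set j : 'I_n | (j < k)%N] ->
  forall c, uniformly_occupied F k (fun h => (fixes F h)%:R) c ->
  mean (fun h => (fixes F h)%:R
      * \prod_(j : 'I_n | (k <= j)%N)
          (if j \in occupied j h then 1 else (j \notin J)%:R))
    = c * \prod_(j : 'I_n | (k <= j)%N)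
        ((j \notin J)%:R + (k - #|F|)%:R / (n - j)%:R).
Proof.
move=> Fk c cU.
pose C i := F :|: [set j : 'I_n | (k <= j < i)%N].
pose f i h : R := (fixes F h)%:R * \prod_(j : 'I_n | (k <= j < i)%N)
          (if j \in occupied j h then 1 else (j \notin J)%:R).
pose d i := c * \prod_(j : 'I_n | (k <= j < i)%N)
        ((j \notin J)%:R + (k - #|F|)%:R / (n - j)%:R).
have inv i : (k <= i <= n)%N ->
    #|C i| = (#|F| + (i - k))%N /\ uniformly_occupied (C i) i (f i) (d i).
  elim: i => [|i IHi].
    rewrite leqn0 => /andP[/eqP k0 _].
    have C0 : C 0%N = F by apply/finset.setP => j; rewrite !inE andbF orbF.
    rewrite C0 k0 addn0; split => // B; rewrite /d big_pred0 ?mulr1; last by move=> j; rewrite andbF.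
    rewrite -[in RHS]k0 -cU k0; apply: eq_mean => h _.
    by rewrite /f big_pred0 ?mulr1// => j; rewrite andbF.
  move=> /andP[ki ilt]; move: ki; rewrite leq_eqVlt => /predU1P[ik|].
    have none (j : 'I_n) : (k <= j < k)%N = false by lia.
    have CF : C k = F by apply/finset.setP => j; rewrite !inE none orbF.
    rewrite -ik CF subnn addn0; split => // B.
    rewrite /d big_pred0 ?mulr1// -cU; apply: eq_mean => h _.
    by rewrite /f big_pred0 ?mulr1.
  rewrite ltnS => ki; have [|cC CU] := IHi; first by rewrite ki ltnW.
  pose i0 := Ordinal ilt.
  have cond (j : 'I_n) : (k <= j < i.+1)%N = (j == i0) || (k <= j < i)%N.
    by rewrite -val_eqE /=; lia.
  have CS : C i.+1 = i0 |: C i.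
    by apply/finset.setP => j; rewrite !inE cond orbCA.
  have iC : i0 \notin C i.
    rewrite !inE ltnn andbF orbF; apply/negP => /(fintype.subsetP Fk).
    by rewrite inE ltnNge ki.
  have prodS (a : 'I_n -> R) : \prod_(j : 'I_n | (k <= j < i.+1)%N) a j
      = (\prod_(j : 'I_n | (k <= j < i)%N) a j) * a i0.
    rewrite (bigD1 i0) /=; last by rewrite ki ltnSn.
    rewrite mulrC; congr (_ * _); apply: eq_bigl => j.
    by rewrite cond; have [->|] := eqVneq; rewrite ?ltnn ?andbF ?andbT.
  have Fle : (#|F| <= k)%N.
    apply: leq_trans (subset_leq_card Fk) _.
    have := @card_occupied n k id kn (fun _ _ _ _ => id).
    by rewrite /occupied imset_id => ->.
  split; first by rewrite CS cardsU1 iC cC; lia.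
  have -> : d i.+1
      = d i * ((i0 \notin J)%:R + 1 * ((i0 - #|C i|)%:R / (n - i0)%:R)).
    rewrite /d prodS mulrA mul1r cC /=; congr (_ * (_ + _%:R / _)); lia.
  rewrite CS => B.
  have := uniformly_occupied_step (i := i0) (i0 \notin J)%:R 1 ki iC _ CU.
  rewrite /= => /(_ _ B) <-.
    by apply: eq_mean => h _; rewrite /f prodS mulrA.
  move=> h h' A; rewrite /f (fixes_agree Fk (agreeW ki A)); congr (_ * _).
  by apply: eq_bigr => j /andP[_ /ltnW ji]; rewrite (occupied_agree (agreeW ji A)).
have [|_ /uniformly_occupied_mean] := inv n; first by rewrite kn leqnn.
have condn (j : 'I_n) : (k <= j < n)%N = (k <= j)%N by rewrite ltn_ord andbT.
rewrite /d (eq_bigl _ _ condn) => <-; apply: eq_mean => h _.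
by rewrite /f (eq_bigl _ _ condn).
Qed.

(** Independence of the later balls given that the balls of [F] are in their own
    pits.  The unknown initial mass [c] is eliminated by comparing with the case
    of an empty [J]. *)
Lemma mean_fixes_misplaced F J : F \subset [set j : 'I_n | (j < k)%N] ->
  J \subset [set j : 'I_n | (k <= j)%N] ->
  mean (fun h => (fixes F h)%:R * \prod_(j in J) (h j != j)%:R)
    = mean (fun h => (fixes F h)%:R)
      * \prod_(j in J) ((k - #|F|)%:R / (n - j + (k - #|F|))%:R).
Proof.
move=> Fk Jk; have [c cU] := fixes_uniformly_occupied Fk.
have -> : mean (fun h => (fixes F h)%:R) = c * \prod_(j : 'I_n | (k <= j)%N)
        (1 + (k - #|F|)%:R / (n - j)%:R).
  have := uniformly_occupied_prod finset.set0 Fk cU.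
  rewrite (eq_bigr (fun j : 'I_n => 1 + (k - #|F|)%:R / (n - j)%:R)); last first.
    by move=> j _; rewrite inE.
  move=> <-; apply: eq_mean => h _; rewrite big1 ?mulr1// => j _.
  by rewrite inE if_same.
rewrite -mulrA [X in _ * (_ * X)](big_mkcond (mem J)) /=.
rewrite [X in _ * (_ * X)](bigID (fun j : 'I_n => (k <= j)%N)) /=.
rewrite [X in _ * (_ * (_ * X))]big1 ?mulr1; last first.
  move=> j; case: (boolP (j \in J)) => // /(fintype.subsetP Jk).
  by rewrite inE => ->.
rewrite -big_split /=.
transitivity (c * \prod_(j : 'I_n | (k <= j)%N)
        ((j \notin J)%:R + (k - #|F|)%:R / (n - j)%:R)).
  rewrite -(uniformly_occupied_prod J Fk cU); apply: eq_mean => h wh.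
  congr (_ * _); rewrite big_mkcond [RHS]big_mkcond /=; apply: eq_bigr => j _.
  case: (boolP (j \in J)) => [/(fintype.subsetP Jk)|_]; last by rewrite !if_same.
  rewrite inE => kj; rewrite kj mem_occupied_misplaced//.
  by case: (h j != j).
congr (_ * _); apply: eq_bigr => j _.
case: (boolP (j \in J)) => _; last by rewrite mulr1.
have nj : (n - j)%:R != 0 :> R by rewrite pnatr_eq0; have := ltn_ord j; lia.
have njk : (n - j + (k - #|F|))%:R != 0 :> R.
  by rewrite pnatr_eq0; have := ltn_ord j; lia.
move: njk; rewrite natrD add0r => njk; field.
by rewrite nj njk.
Qed.

End FiniteModel.

(** * First and second moments *)

Section Moments.
Variables (R : realType) (n k : nat) (w : {ffun 'I_n -> 'I_n} -> R).
Hypotheses (kn : (k <= n)%N) (wP : placement_law k w).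
Implicit Types (h : {ffun 'I_n -> 'I_n}) (F : {set 'I_n}).

Lemma fixes0 h : fixes finset.set0 h.
Proof. by apply/forall_inP => a; rewrite inE. Qed.

Lemma fixes1 (a : 'I_n) h : fixes [set a] h = (h a == a).
Proof. by rewrite -[[set a]]finset.setU0 fixesU1 fixes0. Qed.

Lemma mean_fixes F : F \subset [set j : 'I_n | (j < k)%N] ->
  mean w (fun h => (fixes F h)%:R) = (n ^_ #|F|)%:R^-1.
Proof.
have [m] := ubnP #|F|; elim: m F => // m IHm F; rewrite ltnS => Fm Fk.
have [->|[a aF]] := set_0Vmem F.
  rewrite cards0 invr1 -[RHS](mean_cst wP 1); apply: eq_mean => h _.
  by rewrite fixes0.
have ak : (a < k)%N by move/fintype.subsetP: Fk => /(_ _ aF); rewrite inE.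
have cF := cardsD1 a F; rewrite aF add1n in cF.
have FDk : F :\ a \subset [set j : 'I_n | (j < k)%N].
  exact: fintype.subset_trans (subD1set _ _) Fk.
have := mean_fixesU1 kn wP FDk ak (negbT (setD11 a F)).
rewrite finset.setD1K// IHm//; last by rewrite -cF.
rewrite cF ffactnSr natrM => E.
have nz : (n - #|F :\ a|)%:R != 0 :> R.
  rewrite pnatr_eq0 subn_eq0 -ltnNge -cF.
  by rewrite -[X in (_ <= X)%N]card_ord max_card.
by rewrite invfM E mulrAC mulfV// mul1r.
Qed.

Lemma mean_fixed (a : 'I_n) : (a < k)%N ->
  mean w (fun h => (h a == a)%:R) = n%:R^-1.
Proof.
move=> ak; rewrite -[n in RHS]ffactn1 -(cards1 a) -mean_fixes ?finset.sub1set ?inE//.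
by apply: eq_mean => h _; rewrite fixes1.
Qed.

Lemma mean_fixed2 (a b : 'I_n) : (a < k)%N -> (b < k)%N -> a != b ->
  mean w (fun h => (h a == a)%:R * (h b == b)%:R)
    = (n%:R * (n%:R - 1))^-1.
Proof.
move=> ak bk ab; have n0 : (0 < n)%N by apply: leq_trans kn; apply: leq_trans ak.
transitivity ((n ^_ #|[set a; b]|)%:R^-1 : R); last first.
  by rewrite cards2 ab ffactnS ffactn1 natrM -subn1 natrB.
rewrite -mean_fixes; last first.
  by apply/fintype.subsetP => x; rewrite !inE => /orP[]/eqP ->.
by apply: eq_mean => h _; rewrite -natrM mulnb fixesU1 fixes1 andbC.
Qed.

Lemma mean_misplaced (j : 'I_n) : (k <= j)%N ->
  mean w (fun h => (h j != j)%:R) = k%:R / (n - j + k)%:R.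
Proof.
move=> kj; have := @mean_fixes_misplaced _ _ _ _ kn wP finset.set0 [set j].
rewrite mean_fixes ?finset.sub0set// cards0 invr1 big_set1 mul1r subn0 => <- //.
  apply: eq_mean => h _; rewrite big_set1.
  by rewrite fixes0 mul1r.
by rewrite finset.sub1set inE.
Qed.

Lemma mean_misplaced2 (i j : 'I_n) : (k <= i)%N -> (k <= j)%N -> i != j ->
  mean w (fun h => (h i != i)%:R * (h j != j)%:R)
    = (k%:R / (n - i + k)%:R) * (k%:R / (n - j + k)%:R).
Proof.
move=> ki kj ij; have := @mean_fixes_misplaced _ _ _ _ kn wP finset.set0 [set i; j].
rewrite mean_fixes ?finset.sub0set// cards0 invr1 mul1r subn0.
rewrite big_setU1 ?big_set1 ?inE//= => <- //.
  apply: eq_mean => h _; rewrite big_setU1 ?big_set1 ?inE//=.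
  by rewrite fixes0 mul1r.
by apply/fintype.subsetP => x; rewrite !inE => /orP[]/eqP ->.
Qed.

Lemma mean_fixed_misplaced (a j : 'I_n) : (a < k)%N -> (k <= j)%N ->
  mean w (fun h => (h a == a)%:R * (h j != j)%:R)
    = n%:R^-1 * (k.-1%:R / (n - j + k.-1)%:R).
Proof.
move=> ak kj; have := @mean_fixes_misplaced _ _ _ _ kn wP [set a] [set j].
rewrite mean_fixes ?finset.sub1set ?inE// cards1 ffactn1 big_set1 subn1 => <- //.
by apply: eq_mean => h _; rewrite big_set1 fixes1.
Qed.

(** For ball [j] the substitution [l = n - j + k] turns [k / (n - j + k)] into [k / l]. *)
Lemma sum_from_absent_minded (phi : nat -> R) :
  \sum_(j : 'I_n | (k <= j)%N) phi (n - j + k)%N = \sum_(k.+1 <= l < n.+1) phi l.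
Proof.
transitivity (\sum_(k <= j < n) phi (n - j + k)%N).
  by rewrite (big_nat_widenl _ 0%N)// big_mkord.
rewrite big_add1 /= big_nat_rev /= !big_nat; apply: eq_bigr => l kl.
by congr phi; lia.
Qed.

Definition fixed_count h : R := \sum_(a : 'I_n | (a < k)%N) (h a == a)%:R.

Definition misplaced_count h : R := \sum_(j : 'I_n | (k <= j)%N) (h j != j)%:R.

Definition inv_power_sum (l : nat) : R := \sum_(k.+1 <= j < n.+1) (j%:R ^+ l)^-1.

Lemma sum_absent_minded (c : R) : \sum_(a : 'I_n | (a < k)%N) c = k%:R * c.
Proof.
have cK := @card_occupied n k id kn (fun _ _ _ _ => id).
rewrite /occupied imset_id in cK.
rewrite sumr_const mulr_natl; congr (_ *+ _); rewrite -[RHS]cK.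
by apply: eq_card => a; rewrite !inE.
Qed.

Lemma mean_fixed_count : mean w fixed_count = k%:R / n%:R.
Proof.
rewrite mean_sum (eq_bigr (fun=> n%:R^-1)); last by move=> a /mean_fixed.
by rewrite sum_absent_minded.
Qed.

Lemma mean_sqr_fixed_count : mean w (fun h => fixed_count h ^+ 2)
  = k%:R / n%:R + k%:R * (k%:R - 1) / (n%:R * (n%:R - 1)).
Proof.
pose c : R := (n%:R * (n%:R - 1))^-1.
transitivity (mean w (fun h => \sum_(a : 'I_n | (a < k)%N)
    \sum_(b : 'I_n | (b < k)%N) (h a == a)%:R * (h b == b)%:R)).
  apply: eq_mean => h _; rewrite expr2 /fixed_count big_distrl /=.
  by apply: eq_bigr => a _; rewrite big_distrr.
rewrite mean_sum (eq_bigr (fun=> n%:R^-1 + (k%:R - 1) * c)).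
  by rewrite sum_absent_minded /c; ring.
move=> a ak; rewrite mean_sum (bigD1 a)//=; congr (_ + _).
  rewrite -(mean_fixed ak); apply: eq_mean => h _.
  by case: (h a == a); rewrite ?mulr1 ?mulr0.
rewrite (eq_bigr (fun=> c)); last first.
  by move=> b /andP[bk ba]; rewrite mean_fixed2// eq_sym.
have := sum_absent_minded c; rewrite (bigD1 a)//= => /(canRL (addKr _)) ->.
by ring.
Qed.

Lemma mean_misplaced_count : mean w misplaced_count = k%:R * inv_power_sum 1.
Proof.
rewrite mean_sum (eq_bigr (fun j : 'I_n => k%:R / (n - j + k)%:R)).
  rewrite (sum_from_absent_minded (fun l => k%:R / l%:R)) -big_distrr /=.
  by congr (_ * _); apply: eq_bigr => l _; rewrite expr1.
by move=> j /mean_misplaced.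
Qed.

Lemma mean_sqr_misplaced_count : mean w (fun h => misplaced_count h ^+ 2)
  = (k%:R * inv_power_sum 1) ^+ 2 + k%:R * inv_power_sum 1
    - k%:R ^+ 2 * inv_power_sum 2.
Proof.
pose p (j : 'I_n) : R := k%:R / (n - j + k)%:R.
have sump : \sum_(j : 'I_n | (k <= j)%N) p j = k%:R * inv_power_sum 1.
  rewrite -mean_misplaced_count mean_sum; apply: eq_bigr => j kj.
  by rewrite mean_misplaced.
have sump2 : \sum_(j : 'I_n | (k <= j)%N) p j ^+ 2 = k%:R ^+ 2 * inv_power_sum 2.
  rewrite (sum_from_absent_minded (fun l => (k%:R / l%:R) ^+ 2)) big_distrr /=.
  by apply: eq_bigr => l _; rewrite expr_div_n.
transitivity (mean w (fun h => \sum_(i : 'I_n | (k <= i)%N)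
    \sum_(j : 'I_n | (k <= j)%N) (h i != i)%:R * (h j != j)%:R)).
  apply: eq_mean => h _; rewrite expr2 /misplaced_count big_distrl /=.
  by apply: eq_bigr => a _; rewrite big_distrr.
rewrite mean_sum.
rewrite (eq_bigr (fun i : 'I_n => p i * (k%:R * inv_power_sum 1) + p i - p i ^+ 2)).
  rewrite sumrB big_split /= -big_distrl /= sump sump2; ring.
move=> i ki; rewrite mean_sum -sump (bigD1 i)//= [in RHS](bigD1 i)//=.
rewrite (eq_bigr (fun j : 'I_n => p i * p j)); last first.
  by move=> j /andP[kj ji]; rewrite mean_misplaced2// eq_sym.
rewrite -big_distrr /=.
have -> : mean w (fun h => (h i != i)%:R * (h i != i)%:R) = p i.
  rewrite -[RHS](mean_misplaced ki); apply: eq_mean => h _.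
  by case: (h i == i); rewrite ?mulr1 ?mulr0.
ring.
Qed.

(** With one absent-minded ball in its own pit, the summand [k / l] becomes
    [(k - 1) / (l - 1)]; the shifted harmonic sum differs from the original one in
    the end terms [1 / k] and [1 / n] only. *)
Lemma mean_fixed_misplaced_count : (0 < k)%N -> (0 < n)%N ->
  mean w (fun h => fixed_count h * misplaced_count h)
  = k%:R / n%:R * ((k%:R - 1) * (inv_power_sum 1 - n%:R^-1 + k%:R^-1)).
Proof.
move=> k0 n0.
transitivity (mean w (fun h => \sum_(a : 'I_n | (a < k)%N)
    \sum_(j : 'I_n | (k <= j)%N) (h a == a)%:R * (h j != j)%:R)).
  apply: eq_mean => h _; rewrite /fixed_count big_distrl /=.
  by apply: eq_bigr => a _; rewrite big_distrr.
rewrite mean_sum.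
rewrite (eq_bigr (fun=> n%:R^-1 * ((k%:R - 1) * (inv_power_sum 1 - n%:R^-1 + k%:R^-1)))).
  by rewrite sum_absent_minded mulrA.
move=> a ak; rewrite mean_sum.
rewrite (eq_bigr (fun j : 'I_n => n%:R^-1 * (k.-1%:R / (n - j + k).-1%:R))); last first.
  move=> j kj; rewrite mean_fixed_misplaced//; congr (_ * (_ / _%:R)); lia.
rewrite -big_distrr -big_distrr /=; congr (_ * (_ * _)).
  by rewrite -subn1 natrB.
rewrite (sum_from_absent_minded (fun l => l.-1%:R^-1)) big_add1 /=.
rewrite /inv_power_sum big_add1 /=.
have E1 : \sum_(k <= i < n.+1) (i%:R^-1 : R)
    = \sum_(k <= i < n) (i%:R^-1 : R) + n%:R^-1.
  by rewrite big_nat_recr.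
have E2 : \sum_(k <= i < n.+1) (i%:R^-1 : R)
    = k%:R^-1 + \sum_(k <= i < n) ((i.+1%:R ^+ 1)^-1 : R).
  by rewrite big_nat_recl.
by move: E1; rewrite E2; lra.
Qed.

(** Expansion of [W = k + Y - M], followed by the moments above. *)
Lemma variance_misplaced_count (W : {ffun 'I_n -> 'I_n} -> R) :
  (1 <= k <= n - 1)%N ->
  (forall h, W h = \sum_(i < n) (h i != i)%:R) ->
  mean w (fun h => (W h - mean w W) ^+ 2)
    = k%:R * ((2 * (1 - n%:R + k%:R * n%:R) - n%:R ^+ 2 - k%:R)
               / (n%:R ^+ 2 * (n%:R - 1))
             + 2 / (n%:R * k%:R)
             + (1 + 2 / n%:R) * inv_power_sum 1
             - k%:R * inv_power_sum 2).
Proof.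
move=> /andP[k1 kn1] WE.
have {}WE h : W h = k%:R + (misplaced_count h + (-1) * fixed_count h).
  rewrite WE (bigID (fun i : 'I_n => (k <= i)%N)) /= -/(misplaced_count h).
  rewrite -[k%:R]mulr1 -sum_absent_minded addrCA; congr (_ + _).
  rewrite mulN1r -sumrB; apply: eq_big => i; first by rewrite -ltnNge.
  by case: (h i == i) => _; rewrite /= ?subrr ?subr0.
set mu := mean w W.
have muE : mu = k%:R + (mean w misplaced_count + (-1) * mean w fixed_count).
  by rewrite -meanZ -meanD -[X in X + _](mean_cst wP) -meanD; apply: eq_mean => h _.
transitivity (mean w (fun h => misplaced_count h ^+ 2
    + ((-2) * (fixed_count h * misplaced_count h) + (fixed_count h ^+ 2
    + ((-2 * (mu - k%:R)) * (misplaced_count h + (-1) * fixed_count h)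
    + (mu - k%:R) ^+ 2))))).
  by apply: eq_mean => h _; rewrite WE; ring.
rewrite !(meanD, meanZ, mean_cst wP) muE.
rewrite mean_sqr_misplaced_count mean_fixed_misplaced_count//; last by lia.
rewrite mean_sqr_fixed_count mean_misplaced_count mean_fixed_count.
have n1 : n%:R - 1 != 0 :> R by rewrite subr_eq0 -[1]/(1%:R) eqr_nat; lia.
have n0 : n%:R != 0 :> R by rewrite pnatr_eq0; lia.
have k0 : k%:R != 0 :> R by rewrite pnatr_eq0; lia.
field.
by rewrite n1 n0 k0.
Qed.

End Moments.

Lemma harmonic_numberB (R : realType) (n k : nat) : (k <= n)%N ->
  harmonic_number R n - harmonic_number R k = inv_power_sum R n k 1.
Proof.
move=> kn; rewrite /harmonic_number (big_cat_nat (n := k.+1))//= addrAC subrr add0r.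
by apply: eq_bigr => l _; rewrite expr1.
Qed.

(** * From the probability space to the finite model *)

Local Open Scope classical_set_scope.

Section OutcomeLaw.
Variables (R : realType) (d : measure_display) (T : measurableType d).
Variables (P : probability T R) (n k : nat) (X : 'I_n -> T -> 'I_n).
Hypothesis hX : placement P k X.
Implicit Types (h : {ffun 'I_n -> 'I_n}) (f : {ffun 'I_n -> 'I_n} -> R).

Definition outcome (x : T) : {ffun 'I_n -> 'I_n} := [ffun j => X j x].

Definition outcome_law h : R := fine (P (history X n h)).

Lemma history_outcome h : history X n h = [set x | outcome x = h].
Proof.
apply/seteqP; split => x /=.
  by move=> xh; apply/ffunP => j; rewrite ffunE xh.
by move=> <- j _; rewrite ffunE.
Qed.

Lemma measurable_history m (h : 'I_n -> 'I_n) : measurable (history X m h).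
Proof.
have -> : history X m h
    = \bigcap_(j in [set j : 'I_n | (j < m)%N]) [set x | X j x = h j].
  by apply/seteqP; split => x; apply.
by apply: fin_bigcap_measurable => // j _; apply: (placement_measurable hX).
Qed.

Lemma measurable_outcome (Q : pred {ffun 'I_n -> 'I_n}) :
  measurable [set x | Q (outcome x)].
Proof.
have -> : [set x | Q (outcome x)]
    = \bigcup_(h in [set h | Q h]) history X n h.
  apply/seteqP; split => [x Qx|x [h Qh]]; rewrite ?history_outcome /=.
    by exists (outcome x) => //; rewrite history_outcome.
  by move=> ->.
apply: fin_bigcup_measurable => [|h _]; first exact: finite_finset.
exact: measurable_history.
Qed.

(** The random variable is a finite combination of indicators of complete
    histories. *)
Lemma expectation_outcome f :
  'E_P[fun x => f (outcome x)]%E = (mean outcome_law f)%:E.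
Proof.
rewrite unlock.
transitivity (\int[P]_x \sum_h ((f h)%:E * (\1_(history X n h) x)%:E))%E.
  apply: eq_integral => x _; rewrite (bigD1 (outcome x)) //= big1 ?adde0.
    by rewrite indicE mem_set ?mule1// history_outcome.
  move=> h hx; rewrite indicE memNset ?mule0// history_outcome /= => xh.
  by rewrite xh eqxx in hx.
have mh h : P.-integrable setT (fun x => (\1_(history X n h) x)%:E).
  by apply: integrable_indic; apply: measurable_history.
rewrite integral_sum//; last by move=> h; apply: integrableZl.
rewrite /mean -sumEFin; apply: eq_bigr => h _.
rewrite integralZl// integral_indic//; last exact: measurable_history.
rewrite setIT mulrC EFinM fineK//; apply: fin_num_measure.
exact: measurable_history.
Qed.

Lemma prob_outcome (Q : pred {ffun 'I_n -> 'I_n}) :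
  P [set x | Q (outcome x)] = (\sum_(h | Q h) outcome_law h)%:E.
Proof.
rewrite -expectation_indic; last exact: measurable_outcome.
have -> : \1_[set x | Q (outcome x)] = (fun x => (Q (outcome x))%:R : R).
  by apply/funext => x; rewrite indicE; congr (nat_of_bool _)%:R; apply/idP/idP; rewrite inE.
rewrite (expectation_outcome (fun h => (Q h)%:R)) /mean [in RHS]big_mkcond /=.
by congr EFin; apply: eq_bigr => h _; case: (Q h); rewrite ?mulr1 ?mulr0.
Qed.

Lemma history_agree m (g : 'I_n -> 'I_n) :
  history X m g = [set x | agree m (outcome x) g].
Proof.
apply/seteqP; split => x /= => [xg|/agreeP xg j jm].
  by apply/agreeP => j jm; rewrite ffunE xg.
by rewrite -xg// ffunE.
Qed.

(** For a history of probability zero the conditional probability carries no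
    information, but then both sides of the product formula vanish. *)
Lemma outcome_placement_law : placement_law k outcome_law.
Proof.
have law_ge0 h : 0 <= outcome_law h by apply: fine_ge0.
split => //.
- apply: EFin_inj; rewrite -(prob_outcome xpredT) -(probability_setT P).
  by congr (P _); apply/seteqP; split.
- move=> g ginj; apply: EFin_inj.
  by rewrite -(placement_absent_minded hX ginj) history_agree (prob_outcome (fun h => agree k h g)).
move=> i g p ki.
have PB := prob_outcome (fun h => agree i h g).
have PAB : P ([set x | X i x = p] `&` history X i g)
    = (\sum_(h : {ffun 'I_n -> 'I_n} | agree i h g && (h i == p)) outcome_law h)%:E.
  rewrite -(prob_outcome (fun h => agree i h g && (h i == p))) history_agree.
  congr (P _); apply/seteqP.
  split => x /= => [[xp ->]|/andP[-> /eqP]]; rewrite ffunE ?xp ?eqxx//.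
rewrite -history_agree in PB.
have sum_ge0 : 0 <= \sum_(h : {ffun 'I_n -> 'I_n} | agree i h g) outcome_law h.
  exact: sumr_ge0.
move: sum_ge0; rewrite le_eqVlt => /predU1P[s0|s_gt0].
  rewrite -s0 mul0r big1// => h /andP[hg _].
  exact: (psumr_eq0P (fun u _ => law_ge0 u) (esym s0)).
have := placement_step hX (h := g) p ki; rewrite PB lte_fin => /(_ s_gt0).
rewrite /cond_prob PAB PB /= => <-.
by rewrite mulrC divfK// gt_eqF.
Qed.

Lemma variance_outcome f :
  'V_P[fun x => f (outcome x)]%E
    = (mean outcome_law (fun h => (f h - mean outcome_law f) ^+ 2))%:E.
Proof.
rewrite /variance unlock expectation_outcome /= -expectation_outcome.
by congr expectation; apply/funext => x /=; rewrite expr2.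
Qed.

Lemma misplacedE : misplaced R X
  = (fun x => \sum_(i < n) (outcome x i != i)%:R).
Proof.
apply/funext => x; apply: eq_bigr => i _.
rewrite indicE ffunE; congr (nat_of_bool _)%:R.
apply/idP/idP; rewrite inE /=; first by move/eqP.
by move/eqP.
Qed.

End OutcomeLaw.

Theorem mainTheorem1 (R : realType) (d : measure_display)
    (T : measurableType d) (P : probability T R) (n k : nat)
    (X : 'I_n -> T -> 'I_n) (hk : (1 <= k <= n - 1)%N)
    (hX : placement P k X) :
  'V_P[misplaced R X] =
    (k%:R * ((2 * (1 - n%:R + k%:R * n%:R) - n%:R ^+ 2 - k%:R)
               / (n%:R ^+ 2 * (n%:R - 1))
             + 2 / (n%:R * k%:R)
             + (1 + 2 / n%:R) * (harmonic_number R n - harmonic_number R k)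
             - k%:R * \sum_(k.+1 <= l < n.+1) (l%:R ^+ 2)^-1))%:E.
Proof.
have kn : (k <= n)%N by case/andP: hk => _ /leq_trans; apply; apply: leq_subr.
rewrite misplacedE.
rewrite (variance_outcome hX (fun h => \sum_(i < n) (h i != i)%:R)).
rewrite harmonic_numberB// (variance_misplaced_count kn (outcome_placement_law hX) hk)//.
Qed.
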